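(* For all $\beta\ge1$, all $N\in\mathbb{N}$ and all $C>0$, with $h_w=h_w(\beta)$, $$\mathbb{P}_N^{\beta,h_w}\left(\left\{\phi\in\Omega_N:\ |q_{2+}(\phi)|\ge CN\right\}\right)\le \exp\left(-N\left(\tfrac{C}{20}e^{-6\beta}-4\beta\right)\right).$$
   Context: For an integer $N\ge1$, $\Lambda_N=\{1,\dots,N\}^2\subset\mathbb{Z}^2$; $x\sim y$ means that $x,y$ are nearest neighbors in $\mathbb{Z}^2$; $\partial\Lambda_N=\{x\in\mathbb{Z}^2\setminus\Lambda_N:\exists y\in\Lambda_N,\ x\sim y\}$. Let $\mathbb{Z}_+=\{0,1,2,\dots\}$ and $\Omega_N=\mathbb{Z}_+^{\Lambda_N}$. For $\phi\in\Omega_N$ the Hamiltonian with zero boundary condition is $$\mathcal{H}_N(\phi)=\sum_{\{x,y\}\subset\Lambda_N,\ x\sim y}|\phi(x)-\phi(y)|+\sum_{x\in\Lambda_N,\ y\in\partial\Lambda_N,\ x\sim y}|\phi(x)|.$$ Write $\phi^{-1}(0)=\{x\in\Lambda_N:\phi(x)=0\}$; $|\cdot|$ of a finite set is its cardinality. For $\beta>0$, $h\ge0$, the probability measure $\mathbb{P}_N^{\beta,h}$ on $\Omega_N$ is $$\mathbb{P}_N^{\beta,h}(\phi)=\frac{1}{\mathcal{Z}_N^{\beta,h}}\,e^{-\beta\mathcal{H}_N(\phi)+h|\phi^{-1}(0)|},\qquad \mathcal{Z}_N^{\beta,h}=\sum_{\phi\in\Omega_N}e^{-\beta\mathcal{H}_N(\phi)+h|\phi^{-1}(0)|}<\infty.$$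 The critical pinning parameter is $h_w(\beta)=\log\left(\frac{e^{4\beta}}{e^{4\beta}-1}\right)$. The set of non-isolated zeros of $\phi\in\Omega_N$ is $$q_{2+}(\phi)=\{x\in\Lambda_N:\ \phi(x)=0,\ \exists y\in\Lambda_N,\ y\sim x,\ \phi(y)=0\}.$$ $\mathbb{N}=\{1,2,\dots\}$. *)

(* Defs.v *)
From HB Require Import structures.
From mathcomp Require Import all_boot all_order all_algebra.
From mathcomp Require Import finmap.
From mathcomp Require Import all_classical all_reals all_analysis.
From mathcomp Require Import zify.

Set Implicit Arguments.
Unset Strict Implicit.
Unset Printing Implicit Defensive.

Import Order.TTheory GRing.Theory Num.Theory.

Local Open Scope fset_scope.
Local Open Scope classical_set_scope.
Local Open Scope ring_scope.

Notation site := (int * int)%type.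

(* x ~ y in Z^2: at l^1-distance one. *)
Definition nn (x y : site) : bool :=
  (`|x.1 - y.1| + `|x.2 - y.2| == 1 :> int)%R.

Definition square (m n : nat) : {fset site} :=
  [fset ((i%:Z, j%:Z) : site) | i in iota m n, j in iota m n].

Definition box (N : nat) : {fset site} := square 1 N.

Lemma in_square (m n : nat) (x : site) :
  (x \in square m n) =
  [&& (m%:Z <= x.1), (x.1 < (m + n)%N%:Z), (m%:Z <= x.2) & (x.2 < (m + n)%N%:Z)].
Proof.
apply/idP/idP.
  case/imfset2P => i /=; rewrite mem_iota => /andP[i1 i2].
  case=> j /=; rewrite mem_iota => /andP[j1 j2] -> /=.
  by rewrite !lez_nat !ltz_nat i1 i2 j1 j2.
case: x => -[a|a] [b|b] //=; rewrite ?andbF //.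
move=> /and4P[a1 a2 b1 b2].
by apply/imfset2P; exists a; [|exists b] => //=; rewrite mem_iota;
  apply/andP; split.
Qed.

(* The square {0, ..., N+1}^2 contains every neighbour of the box, so that this
   is the outer boundary in all of Z^2: see bdryP below. *)
Definition bdry (N : nat) : {fset site} :=
  [fset x in square 0 N.+2 | (x \notin box N) && [exists y : box N, nn x (val y)]].

Lemma bdryP (N : nat) (x : site) :
  reflect (x \notin box N /\ exists2 y, y \in box N & nn x y) (x \in bdry N).
Proof.
apply: (iffP idP).
  rewrite !inE => /and3P[_ xN /existsP[y xy]].
  by split=> //; exists (val y) => //; exact: valP.
move=> [xN [y yN xy]]; rewrite !inE xN /=; apply/andP; split; last first.
  by apply/existsP; exists [` yN].
by move: yN xy; rewrite !in_square /nn; lia.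
Qed.

Notation config N := {ffun box N -> nat}.

(* Two neighbours differ by one in exactly one coordinate, so the two
   inequalities select exactly one of (x, y) and (y, x): every unordered pair
   {x, y} contributes once.  `|m - n|%N is the distance between naturals. *)
Definition hamiltonian (N : nat) (phi : config N) : nat :=
  (\sum_(x : box N) \sum_(y : box N |
      [&& nn (val x) (val y), ((val x).1 <= (val y).1)%R
        & ((val x).2 <= (val y).2)%R]) `|phi x - phi y|
   + \sum_(x : box N) \sum_(y : bdry N | nn (val x) (val y)) phi x)%N.

Definition zeros (N : nat) (phi : config N) : {set box N} :=
  [set x | phi x == 0%N].

Definition q2plus (N : nat) (phi : config N) : {set box N} :=
  [set x | (phi x == 0%N) &&
           [exists y : box N, nn (val y) (val x) && (phi y == 0%N)]].

Section gibbs.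
Variables (R : realType) (N : nat) (beta h : R).

Definition weight (phi : config N) : R :=
  expR (- beta * (hamiltonian phi)%:R + h * #|zeros phi|%:R).

Definition partition_function : \bar R :=
  (\esum_(phi in [set: config N]) (weight phi)%:E)%E.

(* fine is harmless: partition_function is finite for beta > 0, see
   partition_function_lty below. *)
Definition gibbs_pmf (phi : config N) : R :=
  weight phi / fine partition_function.

Definition gibbs (A : set (config N)) : \bar R :=
  (\esum_(phi in A) (gibbs_pmf phi)%:E)%E.

End gibbs.

Section sanity.
Variables (R : realType) (N : nat).

Lemma edge_le_hamiltonian (phi : config N) (x y : box N) :
  nn (val x) (val y) -> (val x).1 <= (val y).1 -> (val x).2 <= (val y).2 ->
  (phi y <= phi x + hamiltonian phi)%N.
Proof.
move=> xy x1 x2; rewrite /hamiltonian (bigD1 x) //= (bigD1 y) /=; last first.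
  by rewrite xy x1 x2.
by lia.
Qed.

Lemma bdry_le_hamiltonian (phi : config N) (x : box N) (y : bdry N) :
  nn (val x) (val y) -> (phi x <= hamiltonian phi)%N.
Proof.
move=> xy; rewrite /hamiltonian [X in (_ + X)%N](bigD1 x) //= [X in (_ + (X + _))%N](bigD1 y) //=.
by lia.
Qed.

Lemma site_le_hamiltonian (phi : config N) (x : box N) :
  (phi x <= N * hamiltonian phi)%N.
Proof.
have [k] : exists k : nat, (val x).1 = k%:Z.
  have := valP x; rewrite in_square; case: (val x).1 => [k _|k] //=.
  by exists k.
move=> xk; have kN : (k <= N)%N.
  by have := valP x; rewrite in_square xk; lia.
suff: (phi x <= k * hamiltonian phi)%N.
  by move/leq_trans; apply; rewrite leq_mul2r kN orbT.
clear kN; elim: k x xk => [|k IH] x xk.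
  by have := valP x; rewrite in_square xk.
pose y : site := (k%:Z, (val x).2).
have xy : nn (val x) y by rewrite /nn /y /= xk; lia.
case: (boolP (y \in box N)) => yN.
  have yx : nn y (val x) by rewrite /nn /y /= xk; lia.
  have k1 : (val [` yN]).1 <= (val x).1 by rewrite xk /= lez_nat.
  apply: leq_trans (@edge_le_hamiltonian phi [` yN] x yx k1 (lexx _)) _.
  by rewrite mulSn addnC leq_add2l; exact: IH.
have yb : y \in bdry N.
  apply/bdryP; split=> //; exists (val x); first exact: valP.
  by rewrite /nn /y /= xk; lia.
have := @bdry_le_hamiltonian phi x [` yb] xy; rewrite mulSn; lia.
Qed.

Lemma partition_function_lty (beta h : R) : 0 < beta ->
  (partition_function N beta h < +oo)%E.
Proof.
move=> beta_gt0.
pose n := #|{: box N}|.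
have sum_le (phi : config N) :
    (\sum_(x : box N) phi x <= (n * N) * hamiltonian phi)%N.
  rewrite -mulnA -sum_nat_const; apply: leq_sum => x _.
  exact: site_le_hamiltonian.
pose r : R := expR (- beta / (n * N).+1%:R).
have r_ge0 : 0 <= r by exact: expR_ge0.
have r_lt1 : r < 1 by rewrite expR_lt1 mulNr oppr_lt0 divr_gt0.
pose K : R := expR (`|h| * n%:R).
have wle (phi : config N) : weight beta h phi <= K * \prod_(x : box N) r ^+ phi x.
  rewrite /weight addrC expRD ler_pM ?expR_ge0 //.
    rewrite ler_expR (le_trans (ler_norm _)) // normrM ler_wpM2l //.
    by rewrite normr_nat ler_nat; exact: max_card.
  rewrite -[X in _ <= X]/(\prod_(x : box N) r ^+ phi x).
  rewrite prodrXr /r -expRM_natl ler_expR !mulNr mulrN lerN2 mulrCA.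
  rewrite ler_pM2l // ler_pdivrMr // -natrM ler_nat.
  apply: leq_trans (sum_le phi) _; rewrite mulnC leq_mul2l leqnSn orbT //.
pose G : R := K * ((1 - r)^-1) ^+ n.
apply: (@le_lt_trans _ _ G%:E); last exact: ltry.
apply: ge_ereal_sup => _ /= [A [fA _] <-].
have -> : A = [set` fset_set A] by rewrite fset_setK.
rewrite fsbig_finite //= set_fsetK sumEFin lee_fin.
apply: le_trans (ler_sum _ (fun phi _ => wle phi)) _.
rewrite -mulr_sumr ler_wpM2l ?expR_ge0 //.
pose M := (\max_(phi <- fset_set A) \max_(x : box N) phi x).+1.
pose F (f : {ffun box N -> 'I_M}) : config N := [ffun x => f x : nat].
have F_inj : injective F.
  move=> f g /ffunP fg; apply/ffunP => x; apply/val_inj.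
  by have := fg x; rewrite !ffunE.
have -> : ((1 - r)^-1) ^+ n = \prod_(x : box N) (1 - r)^-1.
  by rewrite prodr_const.
have geo : \sum_(i < M) r ^+ i <= (1 - r)^-1.
  have r1 : 0 < 1 - r by rewrite subr_gt0.
  rewrite -[X in _ <= X]mul1r ler_pdivlMr // mulrC.
  by rewrite -opprB mulNr -subrX1 opprB gerBl exprn_ge0.
apply: (@le_trans _ _ (\prod_(x : box N) \sum_(i < M) r ^+ i)); last first.
  apply: ler_prod => x _; rewrite geo andbT.
  by apply: sumr_ge0 => i _; exact: exprn_ge0.
rewrite bigA_distr_bigA /=.
have sub : {subset (fset_set A : seq (config N)) <= [seq F f | f <- enum {ffun box N -> 'I_M}]}.
  move=> phi phiA; apply/mapP.
  have phiM x : (phi x < M)%N.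
    rewrite ltnS (leq_trans _ (@leq_bigmax_seq _ _ predT (fun phi : config N => \max_(x : box N) phi x)%N phi phiA isT)) //.
    exact: (@leq_bigmax _ (fun x => phi x)).
  exists [ffun x => Ordinal (phiM x)]; first by rewrite mem_enum.
  by apply/ffunP => x; rewrite !ffunE.
have -> : \sum_(f : {ffun box N -> 'I_M}) \prod_(x : box N) r ^+ f x =
    \sum_(phi <- [seq F f | f <- enum {ffun box N -> 'I_M}]) \prod_(x : box N) r ^+ phi x.
  rewrite big_map big_enum /=; apply: eq_bigr => f _; apply: eq_bigr => x _.
  by rewrite ffunE.
have pos (s : seq (config N)) (P : pred (config N)) :
    0 <= \sum_(phi <- s | P phi) \prod_(x : box N) r ^+ phi x.
  by apply: sumr_ge0 => phi _; apply: prodr_ge0 => x _; exact: exprn_ge0.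
rewrite [X in _ <= X](bigID (fun phi => phi \in fset_set A)) /=.
rewrite ler_wpDr // -[X in _ <= X]big_filter le_eqVlt; apply/orP; left.
apply/eqP/perm_big/uniq_perm.
- exact: fset_uniq.
- by apply: filter_uniq; rewrite map_inj_uniq // enum_uniq.
- move=> phi; rewrite mem_filter; case: (boolP (phi \in _)) => //= phiA.
  by rewrite sub.
Qed.

Lemma gibbsE (beta h : R) (A : set (config N)) :
  (gibbs beta h A = (fine (partition_function N beta h))^-1%:E *
                    \esum_(phi in A) (weight beta h phi)%:E)%E.
Proof.
have Z0 : (0 <= partition_function N beta h)%E.
  by apply: esum_ge0 => phi _; rewrite lee_fin expR_ge0.
rewrite /gibbs /esum -ereal_supZl; last 2 first.
- apply/set0P; exists 0%E; exists set0; first exact: fsets_set0.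
  by rewrite fsbig_set0.
- by rewrite invr_ge0 fine_ge0.
congr ereal_sup; rewrite image_comp; apply: eq_imagel => X _ /=.
rewrite ge0_mule_fsumr; last by move=> phi; rewrite lee_fin expR_ge0.
by apply: eq_fsbigr => phi _; rewrite -EFinM mulrC.
Qed.

Lemma gibbs_setT (beta h : R) : 0 < beta ->
  gibbs beta h [set: config N] = 1%E.
Proof.
move=> /(partition_function_lty h) Zoo; rewrite gibbsE.
pose phi0 : config N := [ffun=> 0%N].
have Z_ge : ((weight beta h phi0)%:E <= partition_function N beta h)%E.
  apply: esum_ge; exists [set phi0]; last by rewrite fsbig_set1.
  by split; [exact: finite_set1 | exact: subsetT].
have Z_gt0 : (0 < partition_function N beta h)%E.
  by apply: lt_le_trans Z_ge; rewrite lte_fin expR_gt0.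
rewrite -/(partition_function N beta h) -{2}(@fineK _ (partition_function N beta h)).
  by rewrite -EFinM mulVf // gt_eqF // fine_gt0 // Z_gt0.
by rewrite ge0_fin_numE // ltW.
Qed.

End sanity.

Definition h_w (R : realType) (beta : R) : R :=
  ln (expR (4 * beta) / (expR (4 * beta) - 1)).

(* Main.v *)
(* Lift a configuration phi by one, then put an arbitrary subset B of its zeros
   back to height 0.  The result determines phi and B, its zero set is B, and its
   energy is at most H(phi) + 4 N + 4 |B| - 2 e(B), where e(B) counts the edges
   inside B.  Without e(B), summing over B gives exactly
   (1 + exp(h_w - 4 beta))^|zeros phi| = exp(h_w |zeros phi|), so the total weight
   of the lifts is at least exp(-4 beta N) times the weight of phi.  The term e(B)
   improves this by a factor 1 + exp(-6 beta) (1 - exp(-2 beta)) for each edge of a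
   matching of the zeros, and a greedy matching has at least |q_{2+}(phi)| / 8
   edges. *)
Require Import Defs.
From mathcomp Require Import all_boot all_order all_algebra finmap.
From mathcomp Require Import all_classical all_reals all_analysis.
From mathcomp Require Import zify ring lra.

Set Implicit Arguments.
Unset Strict Implicit.
Unset Printing Implicit Defensive.

Import Order.TTheory GRing.Theory Num.Theory.

Local Open Scope classical_set_scope.
Local Open Scope ring_scope.

(** * Subset sums on a finite graph with a bonus for inner edges *)

Lemma sum_subsetD1 (V : nmodType) (T : finType) (A : {set T}) (x : T)
    (f : {set T} -> V) : x \in A ->
  \sum_(B : {set T} | B \subset A) f B =
  \sum_(B : {set T} | B \subset A :\ x) (f B + f (x |: B)%SET).
Proof.
move=> xA; rewrite (bigID (fun B : {set T} => x \notin B)) /= big_split /=.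
congr (_ + _); first by apply: eq_bigl => B; rewrite subsetD1.
rewrite (reindex_onto (fun B : {set T} => x |: B)%SET (fun B => B :\ x)) /=.
  apply: eq_bigl => B; rewrite finset.setU11 andbT finset.subUset
    finset.sub1set xA /= subsetD1.
  have [xB|xB] := boolP (x \in B); last by rewrite finset.setU1K // eqxx.
  by rewrite (finset.setUidPr _) ?finset.sub1set // andbF; apply/andP => -[_ /eqP/setP/(_ x)];
    rewrite setD11 xB.
by move=> B /andP[_]; rewrite negbK => /finset.setD1K.
Qed.

Section clusters.
Variables (T : finType) (e : rel T).

(** Adjacency is [e x y || e y x]; when [e] orients each edge one way only, every edge inside [B]
    counts once. *)
Definition inner_edges (B : {set T}) : nat :=
  (\sum_(x in B) \sum_(y in B | e x y) 1)%N.

Lemma inner_edgesU1 (x : T) (B : {set T}) : x \notin B ->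
  (\sum_(y in B | e x y || e y x) 1 + inner_edges B <= inner_edges (x |: B)%SET)%N.
Proof.
move=> xB; rewrite /inner_edges finset.big_setU1 //=.
have sub1 (z : T) : (\sum_(y in B | e z y) 1 + (if e z x then 1 else 0)
                     <= \sum_(y in (x |: B)%SET | e z y) 1)%N.
  by rewrite big_mkcondr [X in (_ <= X)%N]big_mkcondr finset.big_setU1 //= addnC.
have := leq_sum (index_enum T) (fun z (_ : z \in B) => sub1 z).
have -> : (\sum_(z in B) (\sum_(y in B | e z y) 1 + (if e z x then 1 else 0)) =
  inner_edges B + \sum_(z in B | e z x) 1)%N by rewrite big_split -big_mkcondr.
rewrite /inner_edges => sub2; have := sub1 x.
have : (\sum_(y in B | e x y || e y x) 1 <=
  \sum_(y in B | e x y) 1 + \sum_(y in B | e y x) 1)%N.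
  rewrite !big_mkcondr -big_split /=; apply: leq_sum => y _.
  by case: (e x y); case: (e y x).
lia.
Qed.

Definition clustered (A : {set T}) : {set T} :=
  [set x in A | [exists y in A, e x y || e y x]].

Variables (R : realFieldType) (a t : R).
Hypotheses (a_ge0 : 0 <= a) (t_ge1 : 1 <= t).

(** Lattice-gas weight with activity [a] and attraction [t] per edge. *)
Definition cluster_weight (B : {set T}) : R := a ^+ #|B| * t ^+ inner_edges B.

Definition cluster_sum (A : {set T}) : R :=
  \sum_(B : {set T} | B \subset A) cluster_weight B.

Lemma cluster_weight_ge0 B : 0 <= cluster_weight B.
Proof. by rewrite mulr_ge0 ?exprn_ge0 // (le_trans ler01). Qed.

Lemma cluster_weightU1 (x : T) (B : {set T}) : x \notin B ->
  a * t ^+ (\sum_(y in B | e x y || e y x) 1) * cluster_weight B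
  <= cluster_weight (x |: B)%SET.
Proof.
move=> xB; rewrite /cluster_weight cardsU1 xB add1n exprS.
rewrite mulrACA -exprD ler_wpM2l ?mulr_ge0 ?exprn_ge0 //.
by rewrite ler_weXn2l // inner_edgesU1.
Qed.

Lemma cluster_sumD1 (x : T) (A : {set T}) : x \in A ->
  (1 + a) * cluster_sum (A :\ x) <= cluster_sum A.
Proof.
move=> xA; rewrite /cluster_sum (sum_subsetD1 _ xA) mulr_sumr; apply: ler_sum => B.
rewrite subsetD1 => /andP[_ xB]; rewrite mulrDl mul1r lerD2l.
apply: le_trans (cluster_weightU1 xB); rewrite ler_wpM2r ?cluster_weight_ge0 //.
by rewrite ler_peMr // exprn_ege1.
Qed.

(** The subsets are grouped by their trace on [x] and [y]. The four traces cost at least 1, [a], [a]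
    and [t * a ^+ 2], the last because the edge between [x] and [y] becomes an inner edge. *)
Lemma cluster_sumD2 (x y : T) (A : {set T}) : x \in A -> y \in A ->
  x != y -> e x y || e y x ->
  (1 + a *+ 2 + t * a ^+ 2) * cluster_sum (A :\ x :\ y) <= cluster_sum A.
Proof.
move=> xA yA xy exy; have yAx : y \in A :\ x by rewrite !inE eq_sym xy.
rewrite /cluster_sum (sum_subsetD1 _ xA) (sum_subsetD1 _ yAx) mulr_sumr.
apply: ler_sum => B; rewrite !subsetD1 => /andP[/andP[_ xB] yB].
have xyB : x \notin (y |: B)%SET by rewrite !inE negb_or xy.
have W0 := cluster_weight_ge0 B.
have aW (z : T) : z \notin B -> a * cluster_weight B <= cluster_weight (z |: B)%SET.
  move=> zB; apply: le_trans (cluster_weightU1 zB).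
  by rewrite ler_wpM2r // ler_peMr // exprn_ege1.
have atW : t * a ^+ 2 * cluster_weight B <= cluster_weight (x |: (y |: B))%SET.
  apply: le_trans (cluster_weightU1 xyB).
  apply: (@le_trans _ _ (a * t * cluster_weight (y |: B)%SET)).
    have -> : t * a ^+ 2 * cluster_weight B = a * t * (a * cluster_weight B) by ring.
    by rewrite ler_wpM2l ?aW // mulr_ge0 // (le_trans ler01).
  rewrite ler_wpM2r ?cluster_weight_ge0 // ler_wpM2l // -[X in X <= _]expr1.
  rewrite ler_weXn2l // (bigD1 y) //=.
  by rewrite !inE eqxx exy.
have := aW _ xB; have := aW _ yB; lra.
Qed.

Hypothesis degree : forall x, (#|[set y | e x y || e y x]%SET| <= 4)%N.

(* Greedy matching: deleting the two ends of an edge removes at most eight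
   points from the clustered set, namely neighbours of one of the ends. *)
Lemma cluster_sum_ge (g : R) (A : {set T}) : irreflexive e -> 0 <= g ->
  (1 + a) ^+ 2 * g <= 1 + a *+ 2 + t * a ^+ 2 ->
  exists2 m, (#|clustered A| <= 8 * m)%N &
    (1 + a) ^+ #|A| * g ^+ m <= cluster_sum A.
Proof.
move=> e_irr g_ge0 gP; have a1 : 0 <= 1 + a by rewrite addr_ge0.
elim: {A}_.+1 {-2}A (ltnSn #|A|) => // n IH A; rewrite ltnS => An.
have [/existsP[x /existsP[y /and3P[xA yA exy]]]|] :=
    boolP [exists x, exists y, [&& x \in A, y \in A & e x y || e y x]].
  have xy : x != y by apply: contraTneq exy => ->; rewrite e_irr.
  have cardA : #|A| = #|A :\ x :\ y|.+2.
    by rewrite (cardsD1 x) xA (cardsD1 y (A :\ x)) !inE eq_sym xy yA.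
  have [|m Am wm] := IH (A :\ x :\ y); first by rewrite (leq_trans _ An) // cardA.
  exists m.+1.
    (* A point with a neighbour in [A] other than [x] and [y] stays clustered; [x] and [y] are
       themselves neighbours of each other. The two degree bounds give 4 + 4 = 8. *)
    have sub : clustered A \subset clustered (A :\ x :\ y)
        :|: ([set z | e x z || e z x] :|: [set z | e y z || e z y]).
      apply/fintype.subsetP => z; rewrite !inE => /andP[zA /existsP[w /andP[wA ezw]]].
      have [->|zx] := eqVneq z x; first by rewrite [e y x || _]orbC exy !orbT.
      have [->|zy] := eqVneq z y; first by rewrite exy !orbT.
      have [wx|wx] := eqVneq w x; first by rewrite -wx [e w z || _]orbC ezw !orbT.
      have [wy|wy] := eqVneq w y; first by rewrite -wy [e w z || _]orbC ezw !orbT.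
      by rewrite zA /=; apply/orP; left; apply/existsP; exists w; rewrite !inE wx wy wA.
    have := subset_leq_card sub; have [+ _] := leq_card_setU (clustered (A :\ x :\ y))
      ([set z | e x z || e z x] :|: [set z | e y z || e z y]).
    have [+ _] := leq_card_setU [set z | e x z || e z x] [set z | e y z || e z y].
    by have := degree x; have := degree y; clear -Am; lia.
  apply: le_trans (cluster_sumD2 xA yA xy exy).
  rewrite cardA -addn2 exprD [g ^+ _]exprS.
  have -> : (1 + a) ^+ #|A :\ x :\ y| * (1 + a) ^+ 2 * (g * g ^+ m) =
    ((1 + a) ^+ 2 * g) * ((1 + a) ^+ #|A :\ x :\ y| * g ^+ m) by ring.
  by rewrite ler_pM // ?mulr_ge0 ?exprn_ge0.
rewrite negb_exists => /forallP noedge.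
(* With no edge left, nothing is clustered: points are removed singly, each giving [1 + a], and the
   bound on [m] is trivial. *)
have [->|[x xA]] := set_0Vmem A.
  exists 0%N; last first.
    rewrite cards0 !expr0 mulr1 /cluster_sum (bigD1 finset.set0) ?finset.sub0set //=.
    rewrite /cluster_weight cards0 /inner_edges big_set0 !expr0 mulr1 lerDl.
    by apply: sumr_ge0 => B _; exact: cluster_weight_ge0.
  by rewrite leqn0 cards_eq0; apply/eqP/setP => x; rewrite !inE.
have cardA : #|A| = #|A :\ x|.+1 by rewrite (cardsD1 x) xA.
have [|m _ wm] := IH (A :\ x); first by rewrite (leq_trans _ An) // cardA.
exists m.
  rewrite (_ : clustered A = finset.set0) ?cards0 //; apply/setP => y; rewrite !inE.
  apply/andP => -[yA /existsP[z /andP[zA yz]]].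
  by have := noedge y; rewrite negb_exists => /forallP/(_ z); rewrite yA zA yz.
apply: le_trans (cluster_sumD1 xA); rewrite cardA exprS -mulrA.
by rewrite ler_wpM2l.
Qed.

End clusters.

(** * Inner and boundary edges of the box *)

Definition upnn (N : nat) (x y : box N) : bool :=
  [&& nn (val x) (val y), (val x).1 <= (val y).1 & (val x).2 <= (val y).2].

Lemma upnn_irr (N : nat) : irreflexive (@upnn N).
Proof. by move=> x; rewrite /upnn /nn; lia. Qed.

Lemma nn_upnn (N : nat) (x y : box N) : nn (val x) (val y) = upnn x y || upnn y x.
Proof. by rewrite /upnn /nn; case: (val x) (val y) => x1 x2 [y1 y2] /=; lia. Qed.

(** The candidates are one step right and one step up; whether the first coordinate is kept tells
    them apart. *)
Lemma card_upnn (N : nat) (x : box N) : (#|[set y | upnn x y]%SET| <= 2)%N.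
Proof.
rewrite -card_bool.
apply: (@leq_card_in _ _ (fun y : box N => (val y).1 == (val x).1)).
move=> y z; rewrite !inE /upnn /nn => yx zx yz; apply: val_inj.
by move: yx zx yz; case: (val x) (val y) (val z) => x1 x2 [y1 y2] [z1 z2] /= *;
  congr (_, _); lia.
Qed.

Lemma card_downnn (N : nat) (x : box N) : (#|[set y | upnn y x]%SET| <= 2)%N.
Proof.
rewrite -card_bool.
apply: (@leq_card_in _ _ (fun y : box N => (val y).1 == (val x).1)).
move=> y z; rewrite !inE /upnn /nn => yx zx yz; apply: val_inj.
by move: yx zx yz; case: (val x) (val y) (val z) => x1 x2 [y1 y2] [z1 z2] /= *;
  congr (_, _); lia.
Qed.

Lemma card_nn (N : nat) (x : box N) : (#|[set y | upnn x y || upnn y x]%SET| <= 4)%N.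
Proof.
have -> : [set y | upnn x y || upnn y x]%SET = [set y | upnn x y] :|: [set y | upnn y x].
  by apply/setP => y; rewrite !inE.
have [+ _] := leq_card_setU [set y | upnn x y] [set y | upnn y x].
have := card_upnn x; have := card_downnn x; lia.
Qed.

(** For an edge leaving the box, this is its position along the side that it crosses. *)
Definition shared_coord (x y : site) : int := if x.1 == y.1 then x.1 else x.2.

(** The axis and the sign of the step from [x] to [y] determine the side crossed, which fixes the
    other coordinate of both ends. *)
Lemma boundary_edge_inj (N : nat) (x y x' y' : site) :
  x \in box N -> x' \in box N -> y \notin box N -> y' \notin box N ->
  nn x y -> nn x' y' -> (x.1 == y.1) = (x'.1 == y'.1) ->
  (x.1 + x.2 < y.1 + y.2) = (x'.1 + x'.2 < y'.1 + y'.2) ->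
  shared_coord x y = shared_coord x' y' -> x = x' /\ y = y'.
Proof.
rewrite !in_square /nn /shared_coord.
case: x x' y y' => [x1 x2] [x1' x2'] [y1 y2] [y1' y2'] /=.
case: (x1 =P y1) => h1; case: (x1' =P y1') => h2 //= b1 b2 b3 b4 n1 n2 _ c2 c3;
  split; congr (_, _); lia.
Qed.

Lemma shared_coord_bound (N : nat) (x y : site) : x \in box N ->
  1 <= shared_coord x y <= N%:Z.
Proof.
by rewrite in_square /shared_coord; case: x y => [x1 x2] [y1 y2] /=; case: ifP; lia.
Qed.

Lemma boundary_edges_le (N : nat) :
  (\sum_(x : box N) \sum_(y : bdry N | nn (val x) (val y)) 1 <= 4 * N)%N.
Proof.
case: N => [|N].
  by rewrite big1 // => x _; have := valP x; rewrite in_square; case: (val x) => * /=; lia.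
rewrite pair_big_dep sum1_card.
have -> : (4 * N.+1 = #|{: bool * bool * 'I_N.+1}|)%N.
  by rewrite !card_prod !card_bool card_ord.
(* Two booleans encode the four sides. Positions run from 1 to [N.+1], so the predecessor fits in
   the ordinal and [inord] never takes its default value. *)
pose code (p : box N.+1 * bdry N.+1) : bool * bool * 'I_N.+1 :=
  let x := val p.1 in let y := val p.2 in
  (x.1 == y.1, x.1 + x.2 < y.1 + y.2, inord `|shared_coord x y|%N.-1).
apply: (@leq_card_in _ _ code) => -[x y] [x' y'] xy xy' cc.
have /bdryP[yb _] := valP y; have /bdryP[yb' _] := valP y'.
have [] := @boundary_edge_inj N.+1 (val x) (val y) (val x') (val y') (valP x)
  (valP x') yb yb' xy xy' (congr1 (fun c => c.1.1) cc) (congr1 (fun c => c.1.2) cc).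
  have := congr1 (fun c => nat_of_ord c.2) cc; rewrite /code.
  have := shared_coord_bound (val y) (valP x).
  have := shared_coord_bound (val y') (valP x').
  move: (shared_coord _ _) (shared_coord _ _) => s s' s1 s1'.
  by rewrite !inordK; lia.
by move=> /val_inj -> /val_inj ->.
Qed.

Lemma hamiltonianE (N : nat) (phi : config N) :
  hamiltonian phi =
  (\sum_(x : box N) \sum_(y : box N | upnn x y) `|phi x - phi y|
   + \sum_(x : box N) \sum_(y : bdry N | nn (val x) (val y)) phi x)%N.
Proof. by []. Qed.

(** * Energy and injectivity of the lift *)

Section lifting.
Variables (N : nat) (phi : config N).

Definition lift_config (B : {set box N}) : config N :=
  [ffun x => if x \in B then 0%N else (phi x).+1].

Lemma zeros_lift B : zeros (lift_config B) = B.
Proof. by apply/setP => x; rewrite !inE ffunE; case: (x \in B). Qed.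

(** Lifting changes no inner gradient and adds one on each of at most [4 * N] boundary edges.
    Resetting [B] adds one on each inner edge with exactly one end in [B]; the sum of degrees over
    [B] counts edges inside [B] twice. *)
Lemma hamiltonian_lift (B : {set box N}) : B \subset zeros phi ->
  (hamiltonian (lift_config B) + 2 * inner_edges (@upnn N) B
   <= hamiltonian phi + 4 * N + 4 * #|B|)%N.
Proof.
move=> /fintype.subsetP B0; rewrite !hamiltonianE.
have B00 x : x \in B -> phi x = 0%N by move=> /B0; rewrite inE => /eqP.
have bd : (\sum_(x : box N) \sum_(y : bdry N | nn (val x) (val y)) lift_config B x
  <= \sum_(x : box N) \sum_(y : bdry N | nn (val x) (val y)) phi x + 4 * N)%N.
  apply: leq_trans (leq_add (leqnn _) (boundary_edges_le N)).
  rewrite -big_split; apply: leq_sum => x _; rewrite -big_split; apply: leq_sum => y _.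
  by rewrite ffunE /=; case: ifP => //; rewrite addn1.
pose one (x : box N) : nat := x \in B.
(* The indicator of exactly one end in [B] is [one x + one y - 2 * one x * one y]; the negative term
   stands on the left to avoid truncated subtraction. *)
have int : (\sum_(x : box N) \sum_(y : box N | upnn x y)
      (`|lift_config B x - lift_config B y| + (one x * one y + one x * one y))
  <= \sum_(x : box N) \sum_(y : box N | upnn x y)
      (`|phi x - phi y| + (one x + one y)))%N.
  apply: leq_sum => x _; apply: leq_sum => y _; rewrite !ffunE /one.
  case: ifP => xB; case: ifP => yB; rewrite ?(B00 _ xB) ?(B00 _ yB); lia.
have sB (F : box N -> nat) : (\sum_(x : box N) one x * F x = \sum_(x in B) F x)%N.
  rewrite [RHS]big_mkcond; apply: eq_bigr => x _.
  by rewrite /one; case: (x \in B); rewrite ?mul1n.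
have e2 : (\sum_(x : box N) \sum_(y : box N | upnn x y) one x * one y
  = inner_edges (@upnn N) B)%N.
  rewrite /inner_edges -sB; apply: eq_bigr => x _; rewrite -big_distrr.
  congr (_ * _)%N; rewrite [RHS]big_mkcondl; apply: eq_bigr => y _.
  by rewrite /one; case: (y \in B).
have deg1 : (\sum_(x : box N) \sum_(y : box N | upnn x y) one x <= 2 * #|B|)%N.
  rewrite mulnC -sum_nat_const -sB; apply: leq_sum => x _.
  rewrite sum_nat_const mulnC leq_mul2l; apply/orP; right.
  by apply: leq_trans (card_upnn x); rewrite cardsE.
have deg2 : (\sum_(x : box N) \sum_(y : box N | upnn x y) one y <= 2 * #|B|)%N.
  rewrite (exchange_big_dep predT) //= mulnC -sum_nat_const -sB; apply: leq_sum => x _.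
  rewrite sum_nat_const mulnC leq_mul2l; apply/orP; right.
  by apply: leq_trans (card_downnn x); rewrite cardsE.
have split2 (P : box N -> box N -> bool) (F G : box N -> box N -> nat) :
  (\sum_(x : box N) \sum_(y : box N | P x y) (F x y + G x y) =
   \sum_(x : box N) \sum_(y : box N | P x y) F x y +
   \sum_(x : box N) \sum_(y : box N | P x y) G x y)%N.
  by rewrite -big_split; apply: eq_bigr => x _; rewrite big_split.
rewrite !split2 e2 in int.
lia.
Qed.

End lifting.

(** The zero set of the lift recovers the subset. Off it heights drop by one, and on it the original
    height was 0. *)
Lemma lift_config_inj (N : nat) (phi psi : config N) (A B : {set box N}) :
  A \subset zeros phi -> B \subset zeros psi ->
  lift_config phi A = lift_config psi B -> phi = psi /\ A = B.
Proof.
move=> A0 B0 eqAB; have AB : A = B by rewrite -(zeros_lift phi A) eqAB zeros_lift.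
split=> //; apply/ffunP => x; move/ffunP/(_ x): eqAB; rewrite !ffunE -AB.
have [xA _|_ [->] //] := boolP (x \in A).
have := fintype.subsetP A0 x xA; have := fintype.subsetP B0 x; rewrite -AB => /(_ xA).
by rewrite !inE => /eqP -> /eqP ->.
Qed.

Lemma q2plus_clustered (N : nat) (phi : config N) :
  q2plus phi = clustered (@upnn N) (zeros phi).
Proof.
apply/setP => x; rewrite !inE; congr (_ && _); apply: eq_existsb => y.
by rewrite !inE nn_upnn andbC; congr (_ && _); exact: orbC.
Qed.

(** The double sum runs over pairs [(phi, B)], on which the lift is injective, so it is the sum of
    [w] over the image. *)
Lemma esum_lift_le (R : realType) (N : nat) (E : set (config N))
    (w : config N -> \bar R) : (forall phi, 0 <= w phi)%E ->
  (\esum_(phi in E) \sum_(B : {set box N} | B \subset zeros phi)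
      w (lift_config phi B) <= \esum_(phi in [set: config N]) w phi)%E.
Proof.
move=> w_ge0; pose J (phi : config N) := [set B : {set box N} | B \subset zeros phi].
have -> : (\esum_(phi in E) \sum_(B : {set box N} | B \subset zeros phi)
    w (lift_config phi B) = \esum_(phi in E) \esum_(B in J phi) w (lift_config phi B))%E.
  apply: eq_esum => phi _.
  rewrite esum_fset //; last exact: finite_finset.
  by rewrite -big_filter fsbig_seq ?filter_uniq ?index_enum_uniq //;
    apply: eq_fsbigl; apply/seteqP; split=> B /=; rewrite mem_filter mem_index_enum andbT.
rewrite esum_esum //.
pose lift (k : config N * {set box N}) := lift_config k.1 k.2.
have lift_inj : {in E `*`` J &, injective lift}.
  move=> [phi A] [psi B]; rewrite !inE => -[_ /= A0] [_ /= B0].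
  by move=> /(lift_config_inj A0 B0)[-> ->].
rewrite -(reindex_esum _ _ _ w (inj_bij lift_inj)) esum_mkcond.
by apply: le_esum => phi _; case: ifP.
Qed.

Lemma ge0_esumZl (R : realType) (T : choiceType) (D : set T) (c : R)
    (a : T -> \bar R) : 0 <= c -> (forall i, 0 <= a i)%E ->
  (\esum_(i in D) (c%:E * a i) = c%:E * \esum_(i in D) a i)%E.
Proof.
move=> c_ge0 a_ge0; rewrite /esum -ereal_supZl //; last first.
  by apply/set0P; exists 0%E; exists set0; [exact: fsets_set0|rewrite fsbig_set0].
congr ereal_sup; rewrite image_comp; apply: eq_imagel => X _ /=.
by rewrite ge0_mule_fsumr.
Qed.

(** * Weights at the critical pinning *)

Section pinning.
Variables (R : realType) (beta : R).

(** This is the criticality equation: the reward for a zero equals the total weight of its two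
    options, staying lifted or returning to 0 at energy cost 4. *)
Lemma expR_h_w : 0 < beta ->
  expR (h_w beta) = 1 + expR (h_w beta - 4 * beta).
Proof.
move=> beta_gt0; have b1 : 1 < expR (4 * beta) by rewrite expR_gt1; lra.
have hw : expR (h_w beta) = expR (4 * beta) / (expR (4 * beta) - 1).
  by rewrite /h_w lnK // posrE divr_gt0 ?expR_gt0 // subr_gt0.
rewrite expRD hw expRN; field.
by rewrite subr_eq0 !gt_eqF //= expR_gt0.
Qed.

(* As a / (1 + a) = exp(-4 beta) for a = exp(h_w - 4 beta), the quotient of the
   right-hand side by (1 + a)^2 is 1 + exp(-6 beta) (1 - exp(-2 beta)), and
   exp(-2 beta) <= 1/3. *)
Lemma pair_gain : 1 <= beta ->
  (1 + expR (h_w beta - 4 * beta)) ^+ 2 * (1 + 2 / 3 * expR (- (6 * beta)))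
  <= 1 + expR (h_w beta - 4 * beta) *+ 2
     + expR (2 * beta) * expR (h_w beta - 4 * beta) ^+ 2.
Proof.
move=> beta_ge1; have beta_gt0 : 0 < beta by lra.
set a := expR (h_w beta - _).
have ea : a = expR (h_w beta) * expR (- (4 * beta)) by rewrite -expRD.
have ee : expR (h_w beta) = 1 + a by exact: expR_h_w.
rewrite -ee.
have -> : 1 + a *+ 2 + expR (2 * beta) * a ^+ 2 =
  expR (h_w beta) ^+ 2 * (1 + (expR (2 * beta) - 1) * expR (- (4 * beta)) ^+ 2).
  rewrite (_ : 1 + _ + _ = (1 + a) ^+ 2 + (expR (2 * beta) - 1) * a ^+ 2); last by ring.
  by rewrite -ee ea; ring.
rewrite ler_wpM2l ?exprn_ge0 ?expR_ge0 // lerD2l mulrBl mul1r.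
have -> : expR (2 * beta) * expR (- (4 * beta)) ^+ 2 = expR (- (6 * beta)).
  by rewrite -expRM_natl -expRD; congr expR; ring.
have -> : expR (- (4 * beta)) ^+ 2 = expR (- (6 * beta)) * expR (- (2 * beta)).
  by rewrite -expRM_natl -expRD; congr expR; ring.
(* Here [expR (2 * beta)] is at least [1 + 2 * beta], hence at least 3. *)
have e3 : expR (- (2 * beta)) <= 1 / 3.
  rewrite expRN -[1 / 3]/(1 * 3^-1) mul1r lef_pV2 ?posrE ?expR_gt0 //.
  by apply: le_trans (expR_ge1Dx _); lra.
have := expR_ge0 (- (6 * beta)); nra.
Qed.

(** With v = 2u/5, exp(v) is at most 1/(1 - v), and (1 + 2u/3)(1 - v) = 1 + 4u(1 - u)/15 is at least
    1. *)
Lemma gain_ge (u : R) : 0 <= u <= 1 -> expR (2 / 5 * u) <= 1 + 2 / 3 * u.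
Proof.
move=> /andP[u0 u1].
have e1 : 1 - 2 / 5 * u <= expR (- (2 / 5 * u)).
  by apply: le_trans (expR_ge1Dx _); lra.
have E0 := expR_gt0 (2 / 5 * u).
have EE : expR (2 / 5 * u) * expR (- (2 / 5 * u)) = 1 by rewrite -expRD subrr expR0.
have E1 : expR (2 / 5 * u) * (1 - 2 / 5 * u) <= 1 by rewrite -[leRHS]EE ler_wpM2l ?expR_ge0.
nra.
Qed.

Variable N : nat.

Lemma weight_lift (phi : config N) (B : {set box N}) : 0 <= beta ->
  B \subset zeros phi ->
  expR (- (4 * beta * N%:R)) * expR (- beta * (hamiltonian phi)%:R) *
  cluster_weight (@upnn N) (expR (h_w beta - 4 * beta)) (expR (2 * beta)) B
  <= weight beta (h_w beta) (lift_config phi B).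
Proof.
move=> beta_ge0 B0; rewrite /weight zeros_lift /cluster_weight -!expRM_natl -!expRD ler_expR.
have H : (hamiltonian (lift_config phi B))%:R + 2 * (inner_edges (@upnn N) B)%:R
    <= (hamiltonian phi)%:R + 4 * N%:R + 4 * #|B|%:R :> R.
  by rewrite -!natrM -!natrD ler_nat hamiltonian_lift.
have := ler_wpM2l beta_ge0 H; lra.
Qed.

(** Summing [weight_lift] over [B] yields a [cluster_sum]; its factor [(1 + a) ^+ #|zeros phi|]
    restores the pinning reward of [phi], and the matching supplies the gain. *)
Lemma weight_le_sum_lift (phi : config N) : 1 <= beta ->
  expR (N%:R * - (4 * beta) + #|q2plus phi|%:R * expR (- (6 * beta)) / 20)
    * weight beta (h_w beta) phi
  <= \sum_(B : {set box N} | B \subset zeros phi)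
        weight beta (h_w beta) (lift_config phi B).
Proof.
move=> beta_ge1; have beta_gt0 : 0 < beta by lra.
pose a := expR (h_w beta - 4 * beta); pose t := expR (2 * beta).
pose u := expR (- (6 * beta)).
have t1 : 1 <= t by rewrite -expR0 ler_expR; lra.
have u01 : 0 <= u <= 1 by rewrite expR_ge0 -expR0 ler_expR; lra.
have g0 : 0 <= 1 + 2 / 3 * u by lra.
have [m qm wm] := cluster_sum_ge (expR_ge0 _ : 0 <= a) t1 (@card_nn N) (zeros phi)
  (@upnn_irr N) g0 (pair_gain beta_ge1).
apply: le_trans (ler_sum _ (fun B => @weight_lift phi B (ltW beta_gt0))); rewrite -mulr_sumr.
rewrite -/(cluster_sum (@upnn N) a t (zeros phi)).
apply: le_trans (ler_wpM2l _ wm); last by rewrite mulr_ge0 ?expR_ge0.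
rewrite -expR_h_w // -expRM_natl.
have gm : expR (2 / 5 * u) ^+ m <= (1 + 2 / 3 * u) ^+ m.
  by rewrite lerXn2r ?nnegrE ?expR_ge0 // gain_ge.
rewrite mulrA; apply: le_trans (ler_wpM2l _ gm); last by rewrite !mulr_ge0 ?expR_ge0.
rewrite -expRM_natl /weight -!expRD ler_expR.
(* The constant 1/20 is 2/5, the gain per matched edge, times 1/8. *)
rewrite q2plus_clustered; have {}qm : #|clustered (@upnn N) (zeros phi)|%:R <= 8 * m%:R :> R.
  by rewrite -natrM ler_nat.
move: u01 => /andP[u0 _]; have := ler_wpM2r u0 qm; rewrite -/u; clear; lra.
Qed.

End pinning.

(** * Comparison of the event with its lifts *)

Theorem theorem1p2 (R : realType) (beta : R) (N : nat) (C : R) :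
  1 <= beta -> (1 <= N)%N -> 0 < C ->
  (gibbs beta (h_w beta) [set phi : config N | (C * N%:R <= #|q2plus phi|%:R)%R]
   <= (expR (- (N%:R * (C / 20 * expR (- (6 * beta)) - 4 * beta))))%:E)%E.
Proof.
move=> beta_ge1 _ _; set E := [set phi | _]; set K : R := - (N%:R * _).
have b0 : 0 < beta by lra.
pose p := gibbs_pmf (N := N) beta (h_w beta).
have p_ge0 phi : 0 <= p phi.
  rewrite divr_ge0 ?expR_ge0 // fine_ge0 //.
  by apply: esum_ge0 => psi _; rewrite lee_fin expR_ge0.
have p_le phi : E phi ->
    p phi <= expR K * \sum_(B : {set box N} | B \subset zeros phi) p (lift_config phi B).
  rewrite /E /= => Ephi; rewrite -mulr_suml mulrA ler_wpM2r //.
    by rewrite invr_ge0 fine_ge0 //; apply: esum_ge0 => psi _; rewrite lee_fin expR_ge0.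
  rewrite -[X in X <= _](mulKf (x := expR (- K))) ?gt_eqF ?expR_gt0 //.
  rewrite -expRN opprK ler_wpM2l ?expR_ge0 //.
  apply: le_trans (weight_le_sum_lift phi beta_ge1).
  rewrite ler_wpM2r ?expR_ge0 // ler_expR.
  have := ler_wpM2r (expR_ge0 (- (6 * beta))) Ephi; rewrite /K; lra.
(* The factor 1 is written as the total Gibbs mass, which dominates the mass of all lifts from
   [E]. *)
rewrite -[leRHS]mule1 -(gibbs_setT N (h_w beta) b0) /gibbs -ge0_esumZl ?expR_ge0 //.
  apply: le_trans (esum_lift_le E _) => [|phi].
    apply: le_esum => phi /p_le; rewrite -lee_fin => /le_trans; apply.
    rewrite EFinM -sumEFin ge0_sume_distrr // => B _; rewrite lee_fin; exact: p_ge0.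
  by rewrite -EFinM lee_fin mulr_ge0 ?expR_ge0 //; exact: p_ge0.
Qed.
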